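(* Let $N$ agents of the form $$\dot x_{j,i}=x_{j+1,i}\ (1\le j\le n_i-1),\qquad \dot x_{n_i,i}=\theta_i^{\mathrm T}\boldsymbol p_i(x_i,t)+u_i,\qquad y_i=x_{1,i},\qquad i=1,\dots,N,$$ be given, where the basis vectors $\boldsymbol p_i$ are known, and satisfy $\|\boldsymbol p_i(x_i,t)\|\le\rho_i(x_i)$ for all $x_i\in\mathbb R^{n_i}$, $t\ge0$ with some smooth function $\rho_i$, and the constant parameter vectors $\theta_i\in\mathbb R^{n_{\theta_i}}$ are unknown. Suppose that each local cost $f_i:\mathbb R\to\mathbb R$ is differentiable, $\underline l$-strongly convex with $\overline l$-Lipschitz gradient for some constants $\underline l,\overline l>0$, and that the weighted undirected graph $\mathcal G$ with adjacency weights $a_{ij}$ is connected. Let $y^*=\arg\min_{y\in\mathbb R}\sum_{i=1}^N f_i(y)$. Let the gains $k_{ji}$ and the matrices $P_i$ be as defined in the context. Then for every $\varepsilon>0$ the distributed controller $$\begin{aligned} u_i&=-\hat\theta_i^{\mathrm T}\boldsymbol p_i(x_i,t)+\frac1{\varepsilon^{n_i}}\Big[k_{1i}(x_{1,i}-r_i)+\sum_{j=2}^{n_i}\varepsilon^{j-1}k_{ji}x_{j,i}\Big],\\ \dot{\hat\theta}_i&=\boldsymbol p_i(x_i,t)\,b_{2i}^{\mathrm T}P_i\hat x_i,\\ \dot r_i&=-\nabla f_i(r_i)-\sum_{j=1}^N a_{ij}(\lambda_i-\lambda_j),\\ \dot\lambda_i&=\sum_{j=1}^N a_{ij}(r_i-r_j),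 \end{aligned}\qquad i=1,\dots,N,$$ where $\hat x_i=\mathrm{col}(x_{1,i}-r_i,\ \varepsilon x_{2,i},\dots,\varepsilon^{n_i-1}x_{n_i,i})$, solves the distributed optimization problem: for every choice of initial conditions of the closed-loop system, (1) all the agents' trajectories $x_i(t)$ are bounded over $[0,+\infty)$, and (2) $\lim_{t\to+\infty}|y_i(t)-y^*|=0$ for $i=1,\dots,N$.
   Context: Agents: $x_{j,i}\in\mathbb R$, $x_i=\mathrm{col}(x_{1,i},\dots,x_{n_i,i})\in\mathbb R^{n_i}$, $u_i,y_i\in\mathbb R$ are the state, input and output of agent $i$; orders $n_i$ may differ between agents. $\mathrm{col}(\cdot)$ denotes stacking into a column vector. $\boldsymbol p_i(x_i,t)\in\mathbb R^{n_{\theta_i}}$. Graph: $\mathcal G$ is a weighted undirected graph on nodes $\{1,\dots,N\}$ with weights $a_{ij}=a_{ji}\ge0$, $a_{ii}=0$, and $a_{ij}>0$ if and only if $i$ and $j$ are joined by an edge. Connected means there is a path between any two nodes. The minimizer $y^*$ exists and is unique, and is finite. Gains: for each $i$, $k_{1i},\dots,k_{n_i i}$ are real constants such that the polynomial $s^{n_i}-k_{n_i i}s^{n_i-1}-\cdots-k_{2i}s-k_{1i}$ is Hurwitz (all roots have negative real part). $A_i\in\mathbb R^{n_i\times n_i}$ is the companion matrix whose first $n_i-1$ rows are $[\,0\mid I_{n_i-1}\,]$ and whose last row is $[k_{1i},k_{2i},\dots,k_{n_i i}]$. $P_i$ is the unique positive definite solution of $A_i^{\mathrm T}P_i+P_iA_i=-2I_{n_i}$.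 $b_{2i}=\mathrm{col}(0,\dots,0,1)\in\mathbb R^{n_i}$. The variables $\hat\theta_i\in\mathbb R^{n_{\theta_i}}$, $r_i,\lambda_i\in\mathbb R$ are the controller states. The closed-loop system consists of the agents together with the controller, with states $x_i,\hat\theta_i,r_i,\lambda_i$, $i=1,\dots,N$. *)

(* Defs.v *)
From HB Require Import structures.
From mathcomp Require Import all_boot all_order all_algebra.
From mathcomp Require Import complex.
From mathcomp Require Import all_classical all_reals all_analysis.

Set Implicit Arguments.
Unset Strict Implicit.
Unset Printing Implicit Defensive.

Import Order.TTheory GRing.Theory Num.Theory.
Import numFieldNormedType.Exports.

Local Open Scope classical_set_scope.
Local Open Scope ring_scope.

Definition dotv (R : realType) (m : nat) (u v : 'cV[R]_m) : R :=
  (u^T *m v) 0 0.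

(* The norm that the library puts on matrices is the sup norm. *)
Definition enorm (R : realType) (m : nat) (v : 'cV[R]_m) : R :=
  Num.sqrt (dotv v v).

(* [f] is of class C^k: all its iterated partial derivatives of order at most
   [k] exist and are continuous. *)
Fixpoint of_classC (R : realType) (n k : nat) (f : 'cV[R]_n -> R) : Prop :=
  continuous f /\
  if k is k'.+1 then
    forall j : 'I_n,
      (forall x, derivable f x (delta_mx j 0)) /\
      of_classC k' (fun x => 'D_(delta_mx j 0) f x)
  else True.

Definition smooth (R : realType) (n : nat) (f : 'cV[R]_n -> R) : Prop :=
  forall k, of_classC k f.

Definition strongly_convex (R : realType) (l : R) (f : R -> R) : Prop :=
  forall (x y t : R), 0 <= t -> t <= 1 ->
    f (t * x + (1 - t) * y) <=
    t * f x + (1 - t) * f y - l / 2 * t * (1 - t) * (x - y) ^+ 2.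

Definition argmin (R : realType) (F : R -> R) : set R :=
  [set y | forall z, F y <= F z].

(* A weighted undirected graph is given by its adjacency weights: [i] and [j]
   are joined by an edge when [0 < a i j]. *)
Definition weighted_graph (R : realType) (N : nat) (a : 'M[R]_N) : Prop :=
  [/\ forall i j, a i j = a j i, forall i j, 0 <= a i j & forall i, a i i = 0].

Definition connected_graph (R : realType) (N : nat) (a : 'M[R]_N) : Prop :=
  forall i j, connect (fun i j => 0 < a i j) i j.

Definition hurwitz (R : realType) (q : {poly R}) : Prop :=
  forall z : R[i], root (map_poly (real_complex R) q) z -> complex.Re z < 0.

(* From here on, an agent has order [n.+1], so that orders are positive; indices
   are shifted by one: the entry of index [j : 'I_n.+1] of the state, resp. of
   the gain vector, is x_{j+1}, resp. k_{j+1}. *)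

Definition gain_poly (R : realType) (n : nat) (k : 'cV[R]_n.+1) : {poly R} :=
  'X^(n.+1) - \sum_(j < n.+1) k j 0 *: 'X^j.

Definition gain_mx (R : realType) (n : nat) (k : 'cV[R]_n.+1) : 'M[R]_n.+1 :=
  \matrix_(i, j) if i == ord_max then k j 0 else (j == i.+1 :> nat)%:R.

Definition posdef (R : realType) (n : nat) (P : 'M[R]_n) : Prop :=
  P^T = P /\ forall v : 'cV[R]_n, v != 0 -> 0 < dotv v (P *m v).

Definition lyapunov_solution (R : realType) (n : nat) (A P : 'M[R]_n) : Prop :=
  posdef P /\ A^T *m P + P *m A = (- 2)%:M.

(* The unit vector col(0, ..., 0, 1). *)
Definition b2 (R : realType) (n : nat) : 'cV[R]_n.+1 := delta_mx ord_max 0.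

Definition scaled_error (R : realType) (n : nat) (eps : R)
    (x : 'cV[R]_n.+1) (r : R) : 'cV[R]_n.+1 :=
  \col_j if j == ord0 then x ord0 0 - r else eps ^+ j * x j 0.

Definition control_input (R : realType) (n m : nat) (eps : R)
    (k : 'cV[R]_n.+1) (th pxt : 'cV[R]_m) (x : 'cV[R]_n.+1) (r : R) : R :=
  - dotv th pxt +
  (eps ^+ n.+1)^-1 *
    (k ord0 0 * (x ord0 0 - r) +
     \sum_(j < n.+1 | j != ord0) eps ^+ j * k j 0 * x j 0).

(* The agent dynamics at time [t], for a trajectory [x] and the value [u] of the
   input at time [t]. *)
Definition agent_ode (R : realType) (n m : nat) (theta : 'cV[R]_m)
    (p : 'cV[R]_n.+1 -> R -> 'cV[R]_m) (x : R -> 'cV[R]_n.+1) (u t : R) : Prop :=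
  (forall j j' : 'I_n.+1, j' = j.+1 :> nat ->
     is_derive t (1 : R) (fun s => x s j 0 : R) (x t j' 0)) /\
  is_derive t (1 : R) (fun s => x s ord_max 0 : R) (dotv theta (p (x t) t) + u).

Definition adaptation_ode (R : realType) (n m : nat) (eps : R) (P : 'M[R]_n.+1)
    (p : 'cV[R]_n.+1 -> R -> 'cV[R]_m) (x : R -> 'cV[R]_n.+1) (r : R -> R)
    (th : R -> 'cV[R]_m) (t : R) : Prop :=
  forall l : 'I_m,
    is_derive t (1 : R) (fun s => th s l 0 : R)
      (p (x t) t l 0 * dotv (b2 R n) (P *m scaled_error eps (x t) (r t))).

Definition optimizer_ode (R : realType) (N : nat) (f : 'I_N -> R -> R)
    (a : 'M[R]_N) (r lam : 'I_N -> R -> R) (i : 'I_N) (t : R) : Prop :=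
  is_derive t (1 : R) (r i)
    (- derive1 (f i) (r i t) - \sum_(j < N) a i j * (lam i t - lam j t)) /\
  is_derive t (1 : R) (lam i) (\sum_(j < N) a i j * (r i t - r j t)).

(* The half-open interval [0, T[, where [T] may be infinite. *)
Definition horizon (R : realType) (T : \bar R) : set R :=
  [set t | 0 <= t /\ (t%:E < T)%E].

(* Classical solutions of the closed-loop system on [0, T[, from arbitrary
   initial conditions: all states are continuous on [0, T[ and the equations
   hold on ]0, T[. *)
Definition closed_loop_solution (R : realType) (N : nat) (n m : 'I_N -> nat)
    (theta : forall i, 'cV[R]_(m i))
    (p : forall i, 'cV[R]_(n i).+1 -> R -> 'cV[R]_(m i))
    (f : 'I_N -> R -> R) (a : 'M[R]_N)
    (k : forall i, 'cV[R]_(n i).+1) (P : forall i, 'M[R]_((n i).+1)) (eps : R)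
    (T : \bar R)
    (x : forall i, R -> 'cV[R]_(n i).+1) (th : forall i, R -> 'cV[R]_(m i))
    (r lam : 'I_N -> R -> R) : Prop :=
  forall i,
    [/\ {within horizon T, continuous (x i)},
        {within horizon T, continuous (th i)},
        {within horizon T, continuous (r i)} &
        {within horizon T, continuous (lam i)}] /\
    (forall t : R, 0 < t -> (t%:E < T)%E ->
      [/\ agent_ode (theta i) (p i) (x i)
            (control_input eps (k i) (th i t) (p i (x i t) t) (x i t) (r i t)) t,
          adaptation_ode eps (P i) (p i) (x i) (r i) (th i) t &
          optimizer_ode f a r lam i t]).

(* Main.v *)
Require Import Defs.
From HB Require Import structures.
From mathcomp Require Import all_boot all_order all_algebra.
From mathcomp Require Import complex.
From mathcomp Require Import all_classical all_reals all_analysis.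
From mathcomp Require Import ring lra.

Set Implicit Arguments.
Unset Strict Implicit.
Unset Printing Implicit Defensive.

Import Order.TTheory GRing.Theory Num.Theory.
Import numFieldNormedType.Exports.

Local Open Scope classical_set_scope.
Local Open Scope ring_scope.

(** Write X = scaled_error eps x r for the error of an agent in the stretched
coordinates, Th = theta - th for its parameter error, and b1 for the first unit
vector.  The closed loop reads
  X' = eps^-1 A X + eps^n (Th . p) b2 - r' b1,    Th' = - (b2 . P X) p,
so in the derivative of V = X . P X + eps^n |Th|^2 the unknown term Th . p
cancels, and the Lyapunov equation leaves
  V' = - (2 / eps) |X|^2 - 2 r' (X . P b1)
    <= - eps^-1 |X|^2 + eps |P b1|^2 r'^2
([is_derive_agent_energy], [agent_energy_decrease]).  The agent is thus driven
by r' only, the speed of the signal generator.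

The generator is a saddle-point flow for minimizing the sum of the f_i under
the constraint L r = 0, where L is the Laplacian.  With e = r - ystar and
mu = lam - ls, where L ls is the opposite of the vector of the slopes at ystar
(it exists because these slopes add up to 0 and the graph is connected), the
flow is e' = - g - L mu and mu' = L e, where g_i = f_i'(r_i) - f_i'(ystar).
The derivative of |e|^2 + |mu|^2 is at most a negative multiple of |e|^2, but r'
also contains L mu; adding the cross term e . L mu to a large multiple of this
sum gives a nonnegative U with U' <= - |r'|^2 / 4 - |e|^2
([optimizer_lyapunov]).

Hence W = V + K U, for K large, is nonnegative with
  W' <= - eps^-1 |X|^2 - e^2,
where e now stands for the component of that agent.  So W is bounded, which
bounds X, Th and r, hence x.  The output error is y - ystar = X_1 + e, so
W' <= - c (y - ystar)^2, and y' is bounded: it is x_2, or, for an agent of order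
one, a function of bounded quantities, as p is bounded by rho.  Barbalat's
argument ([barbalat]) concludes.

Everything is pointwise in time: the input is not assumed to be continuous, so
integrals of derivatives are avoided and the mean value theorem is used
throughout. *)

(** * The Euclidean product of column vectors *)

Section Dot.
Variable R : realType.

Lemma dotvE m (u v : 'cV[R]_m) : dotv u v = \sum_i u i 0 * v i 0.
Proof. by rewrite /dotv mxE; apply: eq_bigr => i _; rewrite mxE. Qed.

Lemma dotvC m (u v : 'cV[R]_m) : dotv u v = dotv v u.
Proof. by rewrite !dotvE; apply: eq_bigr => i _; rewrite mulrC. Qed.

Lemma dotvDr m (w u v : 'cV[R]_m) : dotv w (u + v) = dotv w u + dotv w v.
Proof. by rewrite /dotv mulmxDr mxE. Qed.

Lemma dotvZr m c (u v : 'cV[R]_m) : dotv u (c *: v) = c * dotv u v.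
Proof. by rewrite /dotv -scalemxAr mxE. Qed.

Lemma dotvNr m (u v : 'cV[R]_m) : dotv u (- v) = - dotv u v.
Proof. by rewrite -scaleN1r dotvZr mulN1r. Qed.

Lemma dotvDl m (u v w : 'cV[R]_m) : dotv (u + v) w = dotv u w + dotv v w.
Proof. by rewrite dotvC dotvDr !(dotvC w). Qed.

Lemma dotvZl m c (u v : 'cV[R]_m) : dotv (c *: u) v = c * dotv u v.
Proof. by rewrite dotvC dotvZr dotvC. Qed.

Lemma dotvNl m (u v : 'cV[R]_m) : dotv (- u) v = - dotv u v.
Proof. by rewrite dotvC dotvNr dotvC. Qed.

Definition dotv_lin := (dotvDr, dotvDl, dotvNr, dotvNl, dotvZr, dotvZl).

Lemma dotv_mulmxl m n (M : 'M[R]_(m, n)) u v :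
  dotv (M *m u) v = dotv u (M^T *m v).
Proof. by rewrite /dotv trmx_mul -mulmxA. Qed.

Lemma dotv_delta m (u : 'cV[R]_m) i : dotv (delta_mx i 0) u = u i 0.
Proof.
rewrite dotvE (bigD1 i) //= mxE !eqxx mul1r big1 ?addr0 // => j ji.
by rewrite mxE (negPf ji) mul0r.
Qed.

Lemma dotv_ge0 m (u : 'cV[R]_m) : 0 <= dotv u u.
Proof. by rewrite dotvE sumr_ge0 // => i _; rewrite -expr2 sqr_ge0. Qed.

Lemma sqr_coord_le_dotv m (u : 'cV[R]_m) i : u i 0 ^+ 2 <= dotv u u.
Proof.
rewrite dotvE (bigD1 i) //= -expr2 lerDl sumr_ge0 // => j _.
by rewrite -expr2 sqr_ge0.
Qed.

Lemma dotv_eq0 m (u : 'cV[R]_m) : dotv u u = 0 -> u = 0.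
Proof.
move=> u0; apply/matrixP => i j; rewrite ord1 mxE.
by have := sqr_coord_le_dotv u i; rewrite u0 exprn_even_le0 //= => /eqP.
Qed.

(** Expand the square of c u - v: this form has no square root, and a sign change
of v gives the other bound. *)
Lemma dotv_young m c (u v : 'cV[R]_m) : 0 < c ->
  2 * dotv u v <= c * dotv u u + c^-1 * dotv v v.
Proof.
move=> c0; have := dotv_ge0 (c *: u - v).
rewrite !dotv_lin (dotvC v u) => h.
rewrite -subr_ge0 -(pmulr_rge0 _ c0).
suff -> : c * (c * dotv u u + c^-1 * dotv v v - 2 * dotv u v) =
  c * (c * dotv u u) - c * dotv u v - (c * dotv u v - dotv v v) by lra.
by field; rewrite gt_eqF.
Qed.

End Dot.

(** * Derivatives, monotonicity and Barbalat's argument *)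

Section Calculus.
Variable R : realType.
Implicit Types (T : \bar R) (A : set R).

Lemma is_derive_dotv m (u v : R -> 'cV[R]_m) (du dv : 'cV[R]_m) (t : R) :
  (forall i, is_derive t (1 : R) (fun s => u s i 0 : R) (du i 0)) ->
  (forall i, is_derive t (1 : R) (fun s => v s i 0 : R) (dv i 0)) ->
  is_derive t (1 : R) (fun s => dotv (u s) (v s))
    (dotv du (v t) + dotv (u t) dv).
Proof.
move=> hu hv.
rewrite (_ : (fun s => _) = \sum_i (fun s => u s i 0) * (fun s => v s i 0)).
  apply: is_derive_eq.
  rewrite !dotvE -big_split /=; apply: eq_bigr => i _ /=.
  by rewrite /GRing.scale /= addrC (mulrC (v t i 0)).
by apply/funext => s; rewrite dotvE fct_sumE.
Qed.

Lemma is_derive_mulmx m n (M : 'M[R]_(m, n)) (u : R -> 'cV[R]_n) (du : 'cV[R]_n)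
    (t : R) :
  (forall i, is_derive t (1 : R) (fun s => u s i 0 : R) (du i 0)) ->
  forall i, is_derive t (1 : R) (fun s => (M *m u s) i 0 : R) ((M *m du) i 0).
Proof.
move=> hu i.
rewrite (_ : (fun s => _) = \sum_j (M i j *: (fun s => u s j 0))).
  by apply: is_derive_eq; rewrite mxE.
by apply/funext => s; rewrite mxE fct_sumE.
Qed.

Lemma within_continuousM A (g h : R -> R) :
  {within A, continuous g} -> {within A, continuous h} ->
  {within A, continuous (fun s => g s * h s)}.
Proof. by move=> cg ch x; apply: cvgM; [exact: cg | exact: ch]. Qed.

Lemma within_continuous_cst A (c : R) : {within A, continuous (fun=> c)}.
Proof. by move=> x; exact: cvg_cst. Qed.

Lemma within_continuous_sum A (I : Type) (s : seq I) (g : I -> R -> R) :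
  (forall i, {within A, continuous (g i)}) ->
  {within A, continuous (fun t => \sum_(i <- s) g i t)}.
Proof.
move=> cg; elim: s => [|i s ih].
  rewrite (_ : (fun t => _) = fun=> 0); first exact: within_continuous_cst.
  by apply/funext => t; rewrite big_nil.
rewrite (_ : (fun t => _) = g i + (fun t => \sum_(i <- s) g i t)).
  by apply: within_continuousD.
by apply/funext => t; rewrite big_cons.
Qed.

Lemma within_continuous_dotv A m (u v : R -> 'cV[R]_m) :
  (forall i, {within A, continuous (fun s => u s i 0 : R)}) ->
  (forall i, {within A, continuous (fun s => v s i 0 : R)}) ->
  {within A, continuous (fun s => dotv (u s) (v s))}.
Proof.
move=> cu cv.
rewrite (_ : (fun s => _) = fun s => \sum_i u s i 0 * v s i 0).
  by apply: within_continuous_sum => i; apply: within_continuousM.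
by apply/funext => s; rewrite dotvE.
Qed.

Lemma within_continuous_mulmx A m n (M : 'M[R]_(m, n)) (u : R -> 'cV[R]_n) :
  (forall i, {within A, continuous (fun s => u s i 0 : R)}) ->
  forall i, {within A, continuous (fun s => (M *m u s) i 0 : R)}.
Proof.
move=> cu i.
rewrite (_ : (fun s => _) = fun s => \sum_j M i j * u s j 0).
  apply: within_continuous_sum => j; apply: within_continuousM => //.
  exact: within_continuous_cst.
by apply/funext => s; rewrite mxE.
Qed.

Lemma within_continuous_coord A m (u : R -> 'cV[R]_m) i :
  {within A, continuous u} -> {within A, continuous (fun s => u s i 0 : R)}.
Proof.
move=> cu x.
exact: (continuous_comp (cu x) (@coord_continuous R m 1 i 0 (u x))).
Qed.

(** The solutions are differentiable on ]0, T[ only, so the comparison with the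
initial value rests on continuity at 0. *)
Lemma nonincreasing_horizon T (V dV : R -> R) :
  {within horizon T, continuous V} ->
  (forall t : R, 0 < t -> (t%:E < T)%E -> is_derive t (1 : R) V (dV t)) ->
  (forall t : R, 0 < t -> (t%:E < T)%E -> dV t <= 0) ->
  forall s t, 0 <= s -> s <= t -> (t%:E < T)%E -> V t <= V s.
Proof.
move=> cV dVE dV0 s t s0 st tT.
have [c cst Vst] : exists2 c, c \in `[s, t]%R & V t - V s =
    (if c \in `]s, t[%R then dV c else 0) * (t - s).
  apply: MVT_segment => // [c cst|].
    rewrite cst; apply: dVE; first by rewrite (le_lt_trans s0) ?(itvP cst).
    by apply: le_lt_trans tT; rewrite lee_fin (itvP cst).
  apply: continuous_subspaceW cV => c /=; rewrite in_itv /= => /andP[sc ct].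
  split; first exact: le_trans sc.
  by apply: le_lt_trans tT; rewrite lee_fin.
rewrite -subr_le0 Vst; case: ifP => [cst'|]; last by rewrite mul0r.
rewrite mulr_le0_ge0 ?subr_ge0 //; apply: dV0.
  by rewrite (le_lt_trans s0) ?(itvP cst').
by apply: le_lt_trans tT; rewrite lee_fin (itvP cst').
Qed.

(** The mean value theorem away from the time 0, where differentiability gives
continuity. *)
Lemma derivable_MVT (V dV : R -> R) (s t : R) : s <= t ->
  (forall c, s <= c <= t -> is_derive c (1 : R) V (dV c)) ->
  exists2 c, s <= c <= t & V t - V s = dV c * (t - s).
Proof.
move=> st dVE; have cV : {within `[s, t], continuous V}.
  apply: derivable_within_continuous => c; rewrite in_itv /= => /dVE dVc.
  exact: ex_derive.
have [|c cst ->] := MVT_segment st _ cV (df := dV).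
  by move=> c /subset_itv_oo_cc /= cst; apply: dVE.
by exists c.
Qed.

(** The function V is nonincreasing and bounded below, so past some time it can
no longer drop by a fixed amount.  But whenever |s t| >= d, the bound M on the
slope keeps |s| >= d / 2 for a fixed duration tau, during which V loses at
least eta = c (d / 2)^2 tau. *)
Lemma barbalat (V dV s ds : R -> R) (c M : R) : 0 < c ->
  (forall t : R, 0 < t -> 0 <= V t) ->
  (forall t : R, 0 < t -> is_derive t (1 : R) V (dV t)) ->
  (forall t : R, 0 < t -> dV t <= - c * s t ^+ 2) ->
  (forall t : R, 0 < t -> is_derive t (1 : R) s (ds t)) ->
  (forall t : R, 0 < t -> `|ds t| <= M) ->
  `|s t| @[t --> +oo%R] --> (0 : R).
Proof.
move=> c0 V0 dVE dVle dsE dsM.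
have M0 : 0 <= M by apply: le_trans (dsM 1 _).
apply/cvgrPdist_lt => d d0.
(* The denominator has M + 1 rather than M, as M may be 0. *)
pose tau := d / (2 * (M + 1)).
have tau0 : 0 < tau by rewrite divr_gt0 // mulr_gt0 // ltr_wpDl.
pose eta := c * (d / 2) ^+ 2 * tau.
have eta0 : 0 < eta by rewrite mulr_gt0 // mulr_gt0 // exprn_gt0 // divr_gt0.
have Vni t u : 0 < t -> t <= u -> V u <= V t.
  move=> t0 tu; have [|z /andP[tz _] Vtu] := derivable_MVT tu (V := V) (dV := dV).
    by move=> z /andP[tz _]; apply: dVE; exact: lt_le_trans tz.
  rewrite -subr_le0 Vtu mulr_le0_ge0 ?subr_ge0 //.
  rewrite (le_trans (dVle _ (lt_le_trans t0 tz))) //.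
  by rewrite mulNr oppr_le0 mulr_ge0 ?sqr_ge0 // ltW.
have drop t : 0 < t -> d <= `|s t| -> V (t + tau) <= V t - eta.
  move=> t0 dst; have ttau : t <= t + tau by rewrite lerDl ltW.
  have [|z /andP[tz ztau] Vtu] := derivable_MVT ttau (V := V) (dV := dV).
    by move=> z /andP[tz _]; apply: dVE; exact: lt_le_trans tz.
  have [|w /andP[tw wz] stz] := derivable_MVT tz (V := s) (dV := ds).
    by move=> w /andP[tw _]; apply: dsE; exact: lt_le_trans tw.
  have sz : `|s z - s t| <= d / 2.
    rewrite stz normrM (ger0_norm (_ : 0 <= z - t)) ?subr_ge0 //.
    rewrite (@le_trans _ _ ((M + 1) * tau)) //.
      rewrite ler_pM ?subr_ge0 ?normr_ge0 //; last by rewrite lerBlDl.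
      rewrite (le_trans (dsM _ (lt_le_trans t0 tw))) //; lra.
    by rewrite /tau le_eqVlt; apply/orP; left; apply/eqP; field; lra.
  have {}sz : d / 2 <= `|s z|.
    by have := ler_normB (s z) (s z - s t); rewrite opprB addrC subrK; lra.
  have sz2 : (d / 2) ^+ 2 <= s z ^+ 2.
    by rewrite -(real_normK (num_real (s z))) lerXn2r // ?nnegrE ?divr_ge0 ?ltW.
  have {}Vtu : V (t + tau) = V t + dV z * tau.
    by move/eqP: Vtu; rewrite subr_eq => /eqP ->; rewrite addrC (addrC t) addrK.
  rewrite Vtu lerD2l /eta -mulNr ler_wpM2r ?(ltW tau0) //.
  rewrite (le_trans (dVle _ (lt_le_trans t0 tz))) // mulNr lerN2.
  by rewrite ler_wpM2l // ltW.
pose E := [set V t | t in [set t : R | 0 < t]].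
have E0 : has_inf E.
  split; first by exists (V 1), 1 => //=.
  by exists 0 => _ [t t0 <-]; exact: V0.
have [_ [t0 /= t0gt0 <-] Vt0] := inf_adherent eta0 E0.
exists t0; split; first exact: num_real.
move=> t t0t; rewrite sub0r normrN normr_id ltNge; apply/negP => dst.
have tgt0 : 0 < t by exact: lt_trans t0t.
have infV : inf E <= V (t + tau).
  by apply: ge_inf; [exact: E0.2 | exists (t + tau) => //=; exact: addr_gt0].
have := drop t tgt0 dst; have := Vni t0 t t0gt0 (ltW t0t); lra.
Qed.

End Calculus.

(** * Strong convexity and minimizers *)

Section Convex.
Variable R : realType.

Lemma is_derive_min_right (g : R -> R) (dg : R) :
  is_derive (0 : R) (1 : R) g dg ->
  (forall t : R, 0 < t -> t < 1 -> g 0 <= g t) -> 0 <= dg.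
Proof.
move=> [dgE <-] g0.
apply: (cvgr_to_ge (cvg_dnbhs_at_right dgE)).
near=> t; have t0 : 0 < t by [].
rewrite /= addr0 [_ *: _]mulrC divr_ge0 ?(ltW t0) // subr_ge0 [_%:A]mulr1.
apply: g0 => //; near: t; exact: nbhs_right_lt.
Unshelve. all: by end_near. Qed.

(** Along the segment from y to x, strong convexity says that t c + b t^2 minus
the increment of f is nonnegative; it vanishes at t = 0, so its slope there,
c - f'(y) (x - y), is nonnegative. *)
Lemma strongly_convex_tangent (l : R) (f : R -> R) (x y : R) :
  (forall z, derivable f z (1 : R)) -> strongly_convex l f ->
  f y + derive1 f y * (x - y) + l / 2 * (x - y) ^+ 2 <= f x.
Proof.
move=> df sc.
pose lin (t : R) := t * (x - y) + y.
have dlin : is_derive (0 : R) (1 : R) lin (x - y).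
  rewrite /lin (_ : (fun t => _) = (x - y) \*: (id : R -> R) + cst y).
    by apply: is_derive_eq; rewrite addr0 [_ *: _]mulr1.
  by apply/funext => t /=; rewrite mulrC.
have dflin : is_derive (0 : R) (1 : R) (f \o lin) (derive1 f y * (x - y)).
  apply: is_derive1_comp; rewrite /lin mul0r add0r derive1E.
  exact: derivableP.
pose c := f x - f y - l / 2 * (x - y) ^+ 2.
pose b := l / 2 * (x - y) ^+ 2.
have d1 : is_derive (0 : R) (1 : R) (fun t => c * t : R) c.
  by apply: (is_derive_eq (is_deriveZ c (is_derive_id _ _))); exact: mulr1.
have d2 : is_derive (0 : R) (1 : R) (fun t => b * t ^+ 2 : R) 0.
  apply: (is_derive_eq (is_deriveZ b (is_deriveX 2 (is_derive_id _ _)))).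
  by rewrite expr1 mulr0 scale0r scaler0.
pose g : R -> R := (fun t : R => c * t) + (fun t : R => b * t ^+ 2) - (f \o lin).
have dg : is_derive (0 : R) (1 : R) g (c - derive1 f y * (x - y)).
  apply: (is_derive_eq (is_deriveB (is_deriveD d1 d2) dflin)).
  by rewrite addr0.
suff : 0 <= c - derive1 f y * (x - y) by rewrite /c; lra.
apply: (is_derive_min_right dg) => t t0 t1.
rewrite /g !fctE /lin /= mul0r add0r.
have := sc x y t (ltW t0) (ltW t1).
rewrite (_ : t * x + (1 - t) * y = t * (x - y) + y); last by ring.
rewrite /c /b !expr0n /=; lra.
Qed.

Lemma strongly_monotone_derive1 (l : R) (f : R -> R) (x y : R) :
  (forall z, derivable f z (1 : R)) -> strongly_convex l f ->
  l * (x - y) ^+ 2 <= (derive1 f x - derive1 f y) * (x - y).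
Proof.
move=> df sc.
have := strongly_convex_tangent x y df sc.
have := strongly_convex_tangent y x df sc.
lra.
Qed.

Lemma sum_derive1_argmin N (f : 'I_N -> R -> R) (y : R) :
  (forall i z, derivable (f i) z (1 : R)) ->
  argmin (fun z : R => \sum_(i < N) f i z) y -> \sum_i derive1 (f i) y = 0.
Proof.
move=> df ymin.
have dF : is_derive y (1 : R) (\sum_i f i) (\sum_i derive1 (f i) y).
  by apply: is_derive_sum => i; rewrite derive1E; exact: derivableP.
have dF0 : is_derive y (1 : R) (\sum_i f i) 0.
  apply: (@derive1_at_min _ _ (y - 1) (y + 1)); first lra.
  - by move=> t _; apply: derivable_sum => i; exact: df.
  - by rewrite in_itv /=; lra.
  - by move=> t _; have := ymin t; rewrite !fct_sumE.
by rewrite -(@derive_val _ _ _ _ _ _ _ dF) (@derive_val _ _ _ _ _ _ _ dF0).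
Qed.

End Convex.

(** * Bounds on matrices and quadratic forms *)

Section MatrixBounds.
Variable R : realType.

Lemma dotv_cauchy_schwarz m (u v : 'cV[R]_m) :
  dotv u v ^+ 2 <= dotv u u * dotv v v.
Proof.
have [v0|/eqP v0] := eqVneq (dotv v v) 0.
  by rewrite (dotv_eq0 v0) -(scale0r u) dotvZr mul0r expr0n dotvZr !mul0r mulr0.
have vgt0 : 0 < dotv v v by rewrite lt_def dotv_ge0 andbT; apply/eqP.
have := dotv_ge0 (dotv v v *: u - dotv u v *: v).
rewrite !dotv_lin (dotvC v u) => h.
by rewrite -subr_ge0 -(pmulr_rge0 _ vgt0); move: h; lra.
Qed.

Lemma mulmx_bound m n (M : 'M[R]_(m, n)) :
  exists2 C : R, 0 <= C &
    forall v : 'cV[R]_n, dotv (M *m v) (M *m v) <= C * dotv v v.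
Proof.
exists (\sum_i dotv (row i M)^T (row i M)^T).
  by rewrite sumr_ge0 // => i _; exact: dotv_ge0.
move=> v; rewrite {1}dotvE mulr_suml ler_sum // => i _.
rewrite (_ : (M *m v) i 0 = dotv (row i M)^T v).
  by rewrite -expr2 dotv_cauchy_schwarz.
by rewrite dotvE mxE; apply: eq_bigr => j _; rewrite !mxE.
Qed.

Lemma posdef_unitmx n (Q : 'M[R]_n) : posdef Q -> Q \in unitmx.
Proof.
move=> [Qsym Qpos]; rewrite -row_free_unit -kermx_eq0.
apply/eqP/row_matrixP => i; rewrite row0; apply/eqP; apply: contraT => ki0.
have := Qpos (row i (kermx Q))^T.
rewrite trmx_eq0 ki0 -[Q in Q *m _]Qsym -trmx_mul -row_mul mulmx_ker row0.
by rewrite trmx0 -(scale0r (0 : 'cV[R]_n)) dotvZr mul0r ltxx => /(_ isT).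
Qed.

Lemma posdef_form_ge0 n (Q : 'M[R]_n) v : posdef Q -> 0 <= dotv v (Q *m v).
Proof.
move=> [_ Qpos]; have [->|/Qpos/ltW//] := eqVneq v 0.
by rewrite mulmx0 dotv_ge0.
Qed.

(** Coercivity of Q without eigenvalues: v_i is the Q-product of v with the
solution w of Q w = e_i, and the squares of v + w and of v - w in the Q-product
are nonnegative. *)
Lemma posdef_coord_bound n (Q : 'M[R]_n) : posdef Q ->
  exists C : R, forall (v : 'cV[R]_n) i, `|v i 0| <= C + dotv v (Q *m v).
Proof.
move=> Qpd; have Qu := posdef_unitmx Qpd; have [Qsym _] := Qpd.
pose w i : 'cV[R]_n := invmx Q *m delta_mx i 0.
have Qw i : Q *m w i = delta_mx i 0 by rewrite mulKVmx.
exists (\sum_i dotv (w i) (Q *m w i)) => v i.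
have vw : dotv v (Q *m w i) = v i 0 by rewrite Qw dotvC dotv_delta.
have wv : dotv (w i) (Q *m v) = v i 0.
  by rewrite dotvC dotv_mulmxl Qsym vw.
have := posdef_form_ge0 (v - w i) Qpd.
have := posdef_form_ge0 (v + w i) Qpd.
rewrite mulmxDr mulmxBr !dotv_lin vw wv => h1 h2.
have v0 := posdef_form_ge0 v Qpd.
have wi : dotv (w i) (Q *m w i) <= \sum_i dotv (w i) (Q *m w i).
  rewrite (bigD1 i) //= lerDl sumr_ge0 // => j _; exact: posdef_form_ge0.
have wi0 := posdef_form_ge0 (w i) Qpd.
rewrite ler_norml; apply/andP; split; lra.
Qed.

End MatrixBounds.

(** * The Laplacian of a connected graph *)

Section Laplacian.
Variables (R : realType) (N : nat) (a : 'M[R]_N).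
Hypotheses (a_graph : weighted_graph a) (a_connected : connected_graph a).

Definition laplacian : 'M[R]_N := diag_mx (\row_i \sum_j a i j) - a.

Lemma laplacianE (v : 'cV[R]_N) i : (laplacian *m v) i 0 = \sum_j a i j * (v i 0 - v j 0).
Proof.
rewrite mulmxBl mul_diag_mx !mxE mulr_suml -sumrB.
by apply: eq_bigr => j _; rewrite mulrBr.
Qed.

Lemma laplacian_sym : laplacian^T = laplacian.
Proof.
have [asym _ _] := a_graph.
rewrite linearB /= tr_diag_mx; congr (_ - _).
by apply/matrixP => i j; rewrite mxE asym.
Qed.

Lemma laplacian_form (v : 'cV[R]_N) :
  2 * dotv v (laplacian *m v) =
  \sum_i \sum_j a i j * (v i 0 - v j 0) ^+ 2.
Proof.
have [asym _ _] := a_graph.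
have vLv : dotv v (laplacian *m v) =
    \sum_i \sum_j a i j * (v i 0 * (v i 0 - v j 0)).
  rewrite dotvE; apply: eq_bigr => i _; rewrite laplacianE mulr_sumr.
  by apply: eq_bigr => j _; rewrite mulrCA.
rewrite mulr_natl mulr2n {2}vLv exchange_big /= vLv -big_split /=.
apply: eq_bigr => i _; rewrite -big_split /=; apply: eq_bigr => j _.
by rewrite (asym j i); ring.
Qed.

(** The quadratic form of the Laplacian is a sum of nonnegative terms; when it
vanishes, v takes equal values at the ends of each edge, hence along paths. *)
Lemma laplacian_ker (v : 'cV[R]_N) : laplacian *m v = 0 -> forall i j, v i 0 = v j 0.
Proof.
have [_ age0 _] := a_graph => Lv0.
have term_ge0 i j : 0 <= a i j * (v i 0 - v j 0) ^+ 2.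
  by rewrite mulr_ge0 ?sqr_ge0.
have /eqP := laplacian_form v.
rewrite Lv0 -(scale0r (0 : 'cV[R]_N)) dotvZr mul0r mulr0 eq_sym psumr_eq0.
  move/allP => row0 i j; have /connectP[s + ->] := a_connected i j.
  elim: s i => //= h s ih i /andP[aih /ih <-].
  have := row0 i (mem_index_enum _); rewrite /= psumr_eq0; last first.
    by move=> l _; exact: term_ge0.
  move=> /allP /(_ h (mem_index_enum _)) /=.
  by rewrite mulf_eq0 gt_eqF //= expf_eq0 /= subr_eq0 => /eqP.
by move=> i _; rewrite sumr_ge0.
Qed.

(** A symmetric matrix has as its range the orthogonal of its kernel, which is
made of the constant vectors; the columns of the cokernel lie in the kernel. *)
Lemma laplacian_range (g : 'cV[R]_N) :
  \sum_i g i 0 = 0 -> exists v, laplacian *m v = g.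
Proof.
move=> g0.
have /submxP[w gw] : (g^T <= laplacian)%MS.
  rewrite submxE; apply/eqP/rowP => j; rewrite mxE.
  have kerE : laplacian *m col j (cokermx laplacian) = 0.
    by rewrite colE mulmxA mulmx_coker mul0mx.
  have [i0|noI] := pickP 'I_N; last by have := noI j.
  rewrite mxE (eq_bigr (fun i => cokermx laplacian i0 j * g i 0)).
    by rewrite -mulr_sumr g0 mulr0.
  move=> i _; rewrite mxE mulrC.
  by have := laplacian_ker kerE i i0; rewrite !mxE => ->.
exists w^T; apply: trmx_inj; rewrite trmx_mul trmxK laplacian_sym.
by rewrite gw.
Qed.

End Laplacian.

(** * The signal generator *)

Section Optimizer.
Variables (R : realType) (N : nat) (a : 'M[R]_N) (f : 'I_N -> R -> R).
Variables (lmin lmax ystar : R).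
Hypotheses (lmin_gt0 : 0 < lmin)
    (f_diff : forall (i : 'I_N) (y : R), derivable (f i) y 1)
    (f_strongly_convex : forall i : 'I_N, strongly_convex lmin (f i))
    (f_grad_lipschitz : forall i : 'I_N, lmax.-lipschitz (derive1 (f i)))
    (a_graph : weighted_graph a) (a_connected : connected_graph a)
    (ystarP : argmin (fun y : R => \sum_(i < N) f i y) ystar).

(** The skew coupling of e and mu cancels from the multiple of K; the cross term
produces - |L mu|^2, at the price of terms in |e|^2 that are absorbed by
K lmin |e|^2. *)
Lemma saddle_decrease (L : 'M[R]_N) (Lam K : R) (e mu g de : 'cV[R]_N) :
  de = - g - L *m mu ->
  L^T = L ->
  (forall v : 'cV[R]_N, dotv (L *m v) (L *m v) <= Lam * dotv v v) ->
  lmin * dotv e e <= dotv g e -> dotv g g <= lmax ^+ 2 * dotv e e ->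
  lmax ^+ 2 + Lam + 1 <= K * lmin -> 0 <= K ->
  K * (dotv e de + dotv mu (L *m e)) + (dotv de (L *m mu) + dotv e (L *m (L *m e)))
    <= - (4^-1 * dotv de de + dotv e e).
Proof.
move=> deE Lsym LLam ge gg Kbig K0.
have eLmu : dotv mu (L *m e) = dotv e (L *m mu).
  by rewrite dotvC dotv_mulmxl Lsym.
have eLLe : dotv e (L *m (L *m e)) = dotv (L *m e) (L *m e).
  by rewrite dotv_mulmxl Lsym.
rewrite deE !dotv_lin eLmu eLLe (dotvC e g) (dotvC (L *m mu) g).
have := dotv_young g (- (L *m mu)) (ltr01 : (0 : R) < 1).
rewrite !dotv_lin invr1.
have := LLam e; have := ler_wpM2l K0 ge.
have := ler_wpM2r (dotv_ge0 e) Kbig; have := dotv_ge0 (L *m mu).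
have := dotv_ge0 g.
lra.
Qed.

Lemma saddle_coercive (L : 'M[R]_N) (Lam K : R) (e mu : 'cV[R]_N) :
  (forall v : 'cV[R]_N, dotv (L *m v) (L *m v) <= Lam * dotv v v) ->
  2 <= K -> Lam <= K ->
  2^-1 * dotv e e <= K / 2 * (dotv e e + dotv mu mu) + dotv e (L *m mu).
Proof.
move=> LLam K2 KLam.
have := dotv_young e (- (L *m mu)) (ltr01 : (0 : R) < 1).
rewrite !dotv_lin invr1.
have := LLam mu; have := ler_wpM2r (dotv_ge0 e) K2.
have := ler_wpM2r (dotv_ge0 mu) KLam.
lra.
Qed.

(** Without the cross term e . L mu, the derivative of U would only control
|e|^2, while the agents are disturbed by the speed of r, which contains L mu. *)
Lemma optimizer_lyapunov (T : \bar R) (r lam : 'I_N -> R -> R) :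
  (forall i, {within horizon T, continuous (r i)}) ->
  (forall i, {within horizon T, continuous (lam i)}) ->
  (forall i (t : R), 0 < t -> (t%:E < T)%E -> optimizer_ode f a r lam i t) ->
  exists U dU : R -> R,
    [/\ {within horizon T, continuous U},
        forall t : R, 0 < t -> (t%:E < T)%E -> is_derive t (1 : R) U (dU t),
        forall (t : R) i, 0 < t -> (t%:E < T)%E ->
          dU t <= - (4^-1 * ('D_1 (r i) t) ^+ 2 + (r i t - ystar) ^+ 2) &
        forall (t : R) i, 2^-1 * (r i t - ystar) ^+ 2 <= U t].
Proof.
move=> cr cl ode.
have gsum0 : \sum_i (\col_i - derive1 (f i) ystar : 'cV[R]_N) i 0 = 0.
  rewrite (eq_bigr (fun i => - derive1 (f i) ystar)) => [|i _]; last by rewrite mxE.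
  by rewrite sumrN sum_derive1_argmin ?oppr0.
(* A multiplier: (ystar, ls) is an equilibrium of the flow. *)
have [ls lsE] := laplacian_range a_graph a_connected gsum0.
pose L := laplacian a.
have [Lam Lam0 LLam] := mulmx_bound L.
pose K := 2 + Lam + (lmax ^+ 2 + Lam + 1) / lmin.
pose e t : 'cV[R]_N := \col_i (r i t - ystar).
pose mu t : 'cV[R]_N := \col_i (lam i t - ls i 0).
pose g t : 'cV[R]_N := \col_i (derive1 (f i) (r i t) - derive1 (f i) ystar).
pose de t := - g t - L *m mu t.
have drE i t : 0 < t -> (t%:E < T)%E -> is_derive t (1 : R) (r i) (de t i 0).
  move=> t0 tT; have [dr _] := ode i t t0 tT; apply: (is_derive_eq dr).
  have lsi : \sum_j a i j * (ls i 0 - ls j 0) = - derive1 (f i) ystar.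
    by rewrite -laplacianE lsE mxE.
  have Lmu : (L *m mu t) i 0 =
      \sum_j a i j * (lam i t - lam j t) + derive1 (f i) ystar.
    rewrite -[derive1 _ _]opprK -lsi -sumrB laplacianE.
    by apply: eq_bigr => j _; rewrite !mxE; ring.
  have -> : de t i 0 = - g t i 0 - (L *m mu t) i 0 by rewrite !mxE.
  by rewrite Lmu mxE; ring.
have deE t : 0 < t -> (t%:E < T)%E ->
    forall i, is_derive t (1 : R) (fun s => e s i 0 : R) (de t i 0).
  move=> t0 tT i; rewrite (_ : (fun s => _) = r i - cst ystar).
    by apply: (is_derive_eq (is_deriveB (drE i t t0 tT) _)); rewrite subr0.
  by apply/funext => s; rewrite mxE.
have dmuE t : 0 < t -> (t%:E < T)%E ->
    forall i, is_derive t (1 : R) (fun s => mu s i 0 : R) ((L *m e t) i 0).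
  move=> t0 tT i; have [_ dl] := ode i t t0 tT.
  rewrite (_ : (fun s => _) = lam i - cst (ls i 0)).
    apply: (is_derive_eq (is_deriveB dl _)); rewrite subr0 laplacianE.
    by apply: eq_bigr => j _; rewrite !mxE; ring.
  by apply/funext => s; rewrite mxE.
have lmax_g t : dotv (g t) (g t) <= lmax ^+ 2 * dotv (e t) (e t).
  rewrite !dotvE mulr_sumr ler_sum // => i _; rewrite !mxE -!expr2.
  have lip : `|derive1 (f i) (r i t) - derive1 (f i) ystar| <=
      lmax * `|r i t - ystar|.
    by apply: (f_grad_lipschitz i (x := (r i t, ystar))).
  rewrite -real_normK ?num_real // -[(r i t - _) ^+ 2]real_normK ?num_real //.
  by rewrite -exprMn lerXn2r // nnegrE (le_trans _ lip).
have lmin_g t : lmin * dotv (e t) (e t) <= dotv (g t) (e t).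
  rewrite !dotvE mulr_sumr ler_sum // => i _; rewrite !mxE -expr2.
  exact: strongly_monotone_derive1.
have quot0 : 0 <= (lmax ^+ 2 + Lam + 1) / lmin.
  by rewrite divr_ge0 ?(ltW lmin_gt0) // !addr_ge0 // sqr_ge0.
have K2 : 2 <= K by rewrite /K; lra.
have KLam : Lam <= K by rewrite /K; lra.
have Klmin : lmax ^+ 2 + Lam + 1 <= K * lmin.
  by rewrite /K mulrDl divfK ?gt_eqF // lerDr mulr_ge0 ?(ltW lmin_gt0) // addr_ge0.
have ce i : {within horizon T, continuous (fun s => e s i 0 : R)}.
  rewrite (_ : (fun s => _) = r i - cst ystar).
    by apply: within_continuousB => //; exact: within_continuous_cst.
  by apply/funext => s; rewrite mxE.
have cmu i : {within horizon T, continuous (fun s => mu s i 0 : R)}.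
  rewrite (_ : (fun s => _) = lam i - cst (ls i 0)).
    by apply: within_continuousB => //; exact: within_continuous_cst.
  by apply/funext => s; rewrite mxE.
exists ((K / 2) \*: ((fun t => dotv (e t) (e t)) + (fun t => dotv (mu t) (mu t)))
   + (fun t => dotv (e t) (L *m mu t))).
exists (fun t => K * (dotv (e t) (de t) + dotv (mu t) (L *m e t)) +
   (dotv (de t) (L *m mu t) + dotv (e t) (L *m (L *m e t)))).
split.
- apply: within_continuousD; last first.
    by apply: within_continuous_dotv => //; exact: within_continuous_mulmx.
  apply: within_continuousM; first exact: within_continuous_cst.
  by apply: within_continuousD; exact: within_continuous_dotv.
- move=> t t0 tT.
  have de1 := deE t t0 tT; have dmu1 := dmuE t t0 tT.
  have d1 := is_derive_dotv de1 de1.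
  have d2 := is_derive_dotv dmu1 dmu1.
  have d3 := is_derive_dotv de1 (is_derive_mulmx L dmu1).
  apply: (is_derive_eq (is_deriveD (is_deriveZ (K / 2) (is_deriveD d1 d2)) d3)).
  by rewrite (dotvC (de t) (e t)) (dotvC (L *m e t)) /GRing.scale /=; field.
- move=> t i t0 tT.
  apply: (le_trans (saddle_decrease (erefl (de t)) (laplacian_sym a_graph) LLam (lmin_g t)
    (lmax_g t) Klmin (le_trans (ler0n _ 2) K2))).
  rewrite lerN2 lerD //; last first.
    by rewrite (le_trans _ (sqr_coord_le_dotv _ i)) // mxE.
  rewrite (@derive_val _ _ _ _ _ _ _ (drE i t t0 tT)).
  by rewrite ler_wpM2l // sqr_coord_le_dotv.
- move=> t i; apply: le_trans (saddle_coercive (e t) (mu t) LLam K2 KLam).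
  rewrite ler_wpM2l //.
  by rewrite (le_trans _ (sqr_coord_le_dotv _ i)) // mxE.
Qed.

End Optimizer.

(** * The energy of an agent *)

Lemma ltn_ord_neq_max n (j : 'I_n.+1) : j != ord_max -> (j.+1 < n.+1)%N.
Proof.
rewrite -(inj_eq val_inj) /= => jn.
by rewrite ltnS ltn_neqAle jn -ltnS ltn_ord.
Qed.

Section Agent.
Variables (R : realType) (n m : nat).
Variables (theta : 'cV[R]_m) (p : 'cV[R]_n.+1 -> R -> 'cV[R]_m).
Variables (k : 'cV[R]_n.+1) (P : 'M[R]_n.+1) (eps : R).
Hypotheses (eps_gt0 : 0 < eps) (P_lyapunov : lyapunov_solution (gain_mx k) P).
Variables (x : R -> 'cV[R]_n.+1) (th : R -> 'cV[R]_m) (r : R -> R).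

Let b1 : 'cV[R]_n.+1 := delta_mx ord0 0.
Let X t := scaled_error eps (x t) (r t).
Let Th t := theta - th t.
Let u t := control_input eps k (th t) (p (x t) t) (x t) (r t).

Lemma scaled_errorE t j : X t j 0 = eps ^+ j * x t j 0 - r t * (j == ord0)%:R.
Proof.
rewrite mxE; case: eqP => [->|_]; last by rewrite mulr0 subr0.
by rewrite expr0 mul1r mulr1.
Qed.

Lemma gain_mxE t (j : 'I_n.+1) : (gain_mx k *m X t) j 0 =
  if j == ord_max then \sum_i k i 0 * X t i 0 else X t (inord j.+1) 0.
Proof.
rewrite mxE; have [->|jmax] := eqVneq j ord_max.
  by apply: eq_bigr => i _; rewrite mxE eqxx.
have jn := ltn_ord_neq_max jmax.
rewrite (bigD1 (inord j.+1)) //= mxE (negPf jmax) inordK // eqxx mul1r.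
rewrite big1 ?addr0 // => i ij; rewrite mxE (negPf jmax).
case: eqP => [ij'|_]; last by rewrite mul0r.
by case/eqP: ij; apply: val_inj; rewrite /= inordK.
Qed.

Lemma control_inputE t :
  u t = - dotv (th t) (p (x t) t) +
    (eps ^+ n.+1)^-1 * (gain_mx k *m X t) ord_max 0.
Proof.
rewrite gain_mxE eqxx /u /control_input; congr (_ + _ * _).
rewrite [in RHS](bigD1 ord0) //= [X t ord0 0]mxE eqxx; congr (_ + _).
by apply: eq_bigr => i /negPf i0; rewrite [X t i 0]mxE i0; ring.
Qed.

(** Differentiating eps^j x_j produces eps^-1 times the next entry, and the
factor eps^-(n+1) in the control turns the feedback into the last row of A,
also divided by eps.  When the order is one, the first entry is also the last,
and all three terms of the right-hand side meet. *)
Lemma scaled_error_ode t (dr : R) :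
  agent_ode theta p x (u t) t -> is_derive t (1 : R) r dr ->
  forall j, is_derive t (1 : R) (fun s => X s j 0 : R)
   ((eps^-1 *: (gain_mx k *m X t) + (eps ^+ n * dotv (Th t) (p (x t) t)) *: b2 R n
      - dr *: b1) j 0).
Proof.
move=> [dxj dxn] drE j.
pose dx := if j == ord_max then dotv theta (p (x t) t) + u t
           else x t (inord j.+1) 0.
have epsn0 i : eps ^+ i != 0 by rewrite expf_neq0 // gt_eqF.
have jn := @ltn_ord_neq_max n j.
have dxE : is_derive t (1 : R) (fun s => x s j 0 : R) dx.
  rewrite /dx; have [->|/jn jn'] := eqVneq j ord_max; first exact: dxn.
  by apply: dxj; rewrite inordK.
rewrite (_ : (fun s => _) = (eps ^+ j \*: (fun s => x s j 0)) -
    ((j == ord0)%:R \*: r)); last first.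
  by apply/funext => s; rewrite scaled_errorE !fctE [r s * _]mulrC.
apply: (is_derive_eq (is_deriveB (is_deriveZ _ dxE) (is_deriveZ _ drE))).
have -> : (eps^-1 *: (gain_mx k *m X t) + (eps ^+ n * dotv (Th t) (p (x t) t)) *:
     b2 R n - dr *: b1) j 0 = eps^-1 * (gain_mx k *m X t) j 0 +
     (eps ^+ n * dotv (Th t) (p (x t) t)) * (j == ord_max)%:R
     - dr * (j == ord0)%:R.
  by move: (gain_mx k *m X t) => AX; rewrite !mxE !andbT.
rewrite [_%:R *: dr]mulrC; congr (_ - _); rewrite /dx.
have [->|jmax] := eqVneq j ord_max.
  rewrite control_inputE /Th dotvDl dotvNl /GRing.scale /= exprS.
  by field; rewrite gt_eqF // epsn0.
rewrite mulr0 addr0 gain_mxE (negPf jmax) scaled_errorE.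
rewrite -(inj_eq val_inj) /= inordK ?jn // mulr0 subr0 /GRing.scale /= exprS.
by field; rewrite gt_eqF.
Qed.

Definition agent_energy t : R :=
  dotv (X t) (P *m X t) + eps ^+ n * dotv (Th t) (Th t).

(** The adaptation law is chosen for this cancellation: X . P b2 times Th . p
appears with opposite signs in the two parts of the energy. *)
Lemma is_derive_agent_energy t dr :
  agent_ode theta p x (u t) t -> adaptation_ode eps P p x r th t ->
  is_derive t (1 : R) r dr ->
  is_derive t (1 : R) agent_energy
    (- (2 / eps) * dotv (X t) (X t) - 2 * dr * dotv (X t) (P *m b1)).
Proof.
move=> dx dth drE; have [[Psym _] lyap] := P_lyapunov.
set A := gain_mx k in lyap.
pose w := dotv (b2 R n) (P *m X t).
pose q := p (x t) t.
have dXE := scaled_error_ode dx drE.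
have dThE l : is_derive t (1 : R) (fun s => Th s l 0 : R) ((- w *: q) l 0).
  rewrite (_ : (fun s => _) = cst (theta l 0) - (fun s => th s l 0)).
    apply: (is_derive_eq (is_deriveB _ (dth l))).
    by rewrite sub0r mxE mulNr mulrC.
  by apply/funext => s; rewrite !mxE.
have d1 := is_derive_dotv dXE (is_derive_mulmx P dXE).
have d2 := is_derive_dotv dThE dThE.
apply: (is_derive_eq (is_deriveD d1 (is_deriveZ (eps ^+ n) d2))).
have symP v : dotv (X t) (P *m v) = dotv v (P *m X t).
  by rewrite dotvC dotv_mulmxl Psym.
rewrite symP.
(* The Lyapunov equation enters through the part of X' along A X. *)
have lyapX : 2 * dotv (A *m X t) (P *m X t) = dotv (X t) (- 2 *: X t).
  rewrite -mul_scalar_mx -lyap mulmxDl -!mulmxA dotvDr symP.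
  by rewrite dotv_mulmxl; ring.
rewrite -/q; move: (Th t) => TH.
rewrite !dotv_lin -/w /GRing.scale /= symP -/A.
have -> : - (2 / eps) * dotv (X t) (X t) = eps^-1 * dotv (X t) (- 2 *: X t).
  by rewrite dotvZr; ring.
by rewrite -lyapX (dotvC TH q); ring.
Qed.

Lemma agent_energy_decrease t (dr : R) :
  - (2 / eps) * dotv (X t) (X t) - 2 * dr * dotv (X t) (P *m b1) <=
  - eps^-1 * dotv (X t) (X t) + eps * dotv (P *m b1) (P *m b1) * dr ^+ 2.
Proof.
have einv : 0 < eps^-1 by rewrite invr_gt0.
have := dotv_young (X t) (- dr *: (P *m b1)) einv.
rewrite !dotv_lin invrK; lra.
Qed.

End Agent.

(** * Bounds along the trajectories of an agent *)

Lemma continuous_bounded_cV1 (R : realType) (h : 'cV[R]_1 -> R) (B : R) :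
  continuous h -> exists M : R, forall v : 'cV[R]_1, `|v 0 0| <= B -> h v <= M.
Proof.
move=> ch; have [B0|B0] := ltP B 0.
  by exists 0 => v vB; have := le_lt_trans vB B0; rewrite normr_lt0.
have BB : - B <= B by rewrite (le_trans _ B0) // oppr_le0.
pose line (s : R) : 'cV[R]_1 := s *: delta_mx 0 0.
have ch' : {within `[- B, B], continuous (h \o line)}.
  apply: continuous_subspaceT => s; apply: continuous_comp; last exact: ch.
  exact: scalel_continuous.
have [c _ hc] := EVT_max BB ch'.
exists ((h \o line) c) => v; rewrite ler_norml => vB.
have -> : v = line (v 0 0).
  by apply/matrixP => i j; rewrite !ord1 !mxE !eqxx mulr1.
exact: hc.
Qed.

Section AgentBounds.
Variables (R : realType) (n m : nat).
Variables (theta : 'cV[R]_m) (p : 'cV[R]_n.+1 -> R -> 'cV[R]_m).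
Variables (rho : 'cV[R]_n.+1 -> R) (k : 'cV[R]_n.+1) (eps : R).
Hypotheses (rho_smooth : smooth rho)
  (p_bound : forall (v : 'cV[R]_n.+1) (t : R), 0 <= t -> enorm (p v t) <= rho v).
Variables (x : R -> 'cV[R]_n.+1) (th : R -> 'cV[R]_m) (r : R -> R).

(** The derivative of the output is the second state variable if there is one.
Otherwise it contains Th . p, and p is bounded because the state ranges over a
compact interval, on which rho is bounded. *)
Lemma output_derivative_bounded (B : R) :
  (forall t : R, 0 < t ->
     agent_ode theta p x (control_input eps k (th t) (p (x t) t) (x t) (r t)) t) ->
  (forall (t : R) j, 0 < t -> `|x t j 0| <= B) ->
  (forall t : R, 0 < t -> `|r t| <= B) ->
  (forall t : R, 0 < t -> dotv (theta - th t) (theta - th t) <= B) ->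
  exists (dy : R -> R) (M : R), forall t : R, 0 < t ->
    is_derive t (1 : R) (fun s => x s ord0 0 : R) (dy t) /\ `|dy t| <= M.
Proof.
move: p rho k rho_smooth p_bound x.
case: n => [|n'] p' rho' k' rho_s p_b x' ode xB rB thB; last first.
  exists (fun t => x' t (inord 1) 0), B => t t0; split; last exact: xB.
  by have [dx _] := ode t t0; apply: dx; rewrite inordK.
have [M rhoM] := continuous_bounded_cV1 B (rho_s 0%N).1.
pose dy t := dotv (theta - th t) (p' (x' t) t) +
  (eps ^+ 1)^-1 * (k' ord0 0 * (x' t ord0 0 - r t)).
exists dy, (B + M ^+ 2 + `|(eps ^+ 1)^-1| * (`|k' ord0 0| * (B + B))) => t t0.
split.
  have [_] := ode t t0; rewrite (_ : ord_max = ord0) //; last exact: val_inj.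
  move=> dx; apply: (is_derive_eq dx).
  rewrite /dy /control_input big_pred0; last by move=> j; rewrite ord1.
  by rewrite dotvDl dotvNl addr0; ring.
have pp : dotv (p' (x' t) t) (p' (x' t) t) <= M ^+ 2.
  have pM : enorm (p' (x' t) t) <= M.
    by apply: le_trans (p_b _ _ (ltW t0)) (rhoM _ _); exact: xB.
  rewrite -(sqr_sqrtr (dotv_ge0 (p' (x' t) t))).
  by rewrite lerXn2r ?nnegrE ?sqrtr_ge0 // (le_trans _ pM) ?sqrtr_ge0.
rewrite /dy (le_trans (ler_normD _ _)) // lerD //; last first.
  rewrite !normrM ler_wpM2l // ler_wpM2l // (le_trans (ler_normB _ _)) //.
  by rewrite lerD // ?xB ?rB.
have := dotv_young (theta - th t) (p' (x' t) t) (ltr01 : (0 : R) < 1).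
have := dotv_young (theta - th t) (- p' (x' t) t) (ltr01 : (0 : R) < 1).
have := thB t t0; have := dotv_ge0 (theta - th t); have := dotv_ge0 (p' (x' t) t).
move: (theta - th t) pp => TH; rewrite !dotv_lin invr1 ler_norml => *.
by apply/andP; split; lra.
Qed.

End AgentBounds.

Lemma within_continuous_agent_energy (R : realType) (n m : nat) (theta : 'cV[R]_m)
    (P : 'M[R]_n.+1) (eps : R) (x : R -> 'cV[R]_n.+1) (th : R -> 'cV[R]_m)
    (r : R -> R) (A : set R) :
  {within A, continuous x} -> {within A, continuous th} ->
  {within A, continuous r} ->
  {within A, continuous (agent_energy theta P eps x th r)}.
Proof.
move=> cx cth cr.
have cX j : {within A, continuous (fun s => scaled_error eps (x s) (r s) j 0 : R)}.
  rewrite (_ : (fun s => _) =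
      (fun s => eps ^+ j * x s j 0) - (fun s => r s * (j == ord0)%:R)).
    apply: within_continuousB; apply: within_continuousM => //;
      try exact: within_continuous_cst.
    exact: within_continuous_coord.
  by apply/funext => s; rewrite scaled_errorE.
have cTh l : {within A, continuous (fun s => (theta - th s) l 0 : R)}.
  rewrite (_ : (fun s => _) = (fun=> theta l 0) - (fun s => th s l 0)).
    apply: within_continuousB; first exact: within_continuous_cst.
    exact: within_continuous_coord.
  by apply/funext => s; rewrite !mxE.
apply: within_continuousD.
  by apply: within_continuous_dotv => //; exact: within_continuous_mulmx.
apply: within_continuousM; first exact: within_continuous_cst.
exact: within_continuous_dotv.
Qed.

(** * Convergence of the closed loop *)

Theorem theorem2 (R : realType) (N : nat) (n m : 'I_N -> nat)
    (theta : forall i : 'I_N, 'cV[R]_(m i))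
    (p : forall i : 'I_N, 'cV[R]_(n i).+1 -> R -> 'cV[R]_(m i))
    (rho : forall i : 'I_N, 'cV[R]_(n i).+1 -> R)
    (f : 'I_N -> R -> R) (lmin lmax : R) (a : 'M[R]_N) (ystar : R)
    (k : forall i : 'I_N, 'cV[R]_(n i).+1)
    (P : forall i : 'I_N, 'M[R]_((n i).+1))
    (rho_smooth : forall i : 'I_N, smooth (rho i))
    (p_bound : forall (i : 'I_N) (x : 'cV[R]_(n i).+1) (t : R),
        0 <= t -> enorm (p i x t) <= rho i x)
    (lmin_gt0 : 0 < lmin) (lmax_gt0 : 0 < lmax)
    (f_diff : forall (i : 'I_N) (y : R), derivable (f i) y 1)
    (f_strongly_convex : forall i : 'I_N, strongly_convex lmin (f i))
    (f_grad_lipschitz : forall i : 'I_N, lmax.-lipschitz (derive1 (f i)))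
    (a_graph : weighted_graph a) (a_connected : connected_graph a)
    (ystarE : argmin (fun y : R => \sum_(i < N) f i y) = [set ystar])
    (k_hurwitz : forall i : 'I_N, hurwitz (gain_poly (k i)))
    (P_lyapunov : forall i : 'I_N, lyapunov_solution (gain_mx (k i)) (P i)) :
  forall eps : R, 0 < eps ->
  forall (T : \bar R) (x : forall i : 'I_N, R -> 'cV[R]_(n i).+1)
      (th : forall i : 'I_N, R -> 'cV[R]_(m i)) (r lam : 'I_N -> R -> R),
    (0 < T)%E ->
    closed_loop_solution theta p f a k P eps T x th r lam ->
    (forall i : 'I_N, exists M : R,
        forall t : R, 0 <= t -> (t%:E < T)%E -> enorm (x i t) <= M) /\
    (T = +oo%E ->
      forall i : 'I_N, `|x i t ord0 0 - ystar| @[t --> +oo%R] --> (0 : R)).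
Proof.
move=> eps eps_gt0 T x th r lam T_gt0 sol.
have ode i (t : R) t0 tT := (sol i).2 t t0 tT.
have cx i : {within horizon T, continuous (x i)} by have [[]] := sol i.
have cth i : {within horizon T, continuous (th i)} by have [[]] := sol i.
have cr i : {within horizon T, continuous (r i)} by have [[]] := sol i.
have cl i : {within horizon T, continuous (lam i)} by have [[]] := sol i.
have ystarP : argmin (fun y : R => \sum_(i < N) f i y) ystar.
  by rewrite ystarE.
have [|U [dU [cU dUE dUle Ule]]] := optimizer_lyapunov (lmax := lmax) lmin_gt0 f_diff
    f_strongly_convex f_grad_lipschitz a_graph a_connected ystarP cr cl.
  by move=> i t t0 tT; have [] := ode i t t0 tT.
suff agent i :
    (exists M : R, forall t : R, 0 <= t -> (t%:E < T)%E -> enorm (x i t) <= M) /\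
    (T = +oo%E -> `|x i t ord0 0 - ystar| @[t --> +oo%R] --> (0 : R)).
  by split => [i|Too i]; [exact: (agent i).1 | exact: (agent i).2].
have [Ppd _] := P_lyapunov i.
pose X t := scaled_error eps (x i t) (r i t).
pose Th t := theta i - th i t.
pose V := agent_energy (theta i) (P i) eps (x i) (th i) (r i).
pose b1 : 'cV[R]_(n i).+1 := delta_mx ord0 0.
pose C := eps * dotv (P i *m b1) (P i *m b1).
have C0 : 0 <= C by rewrite mulr_ge0 ?(ltW eps_gt0) ?dotv_ge0.
(* The coefficient 1/4 of r'^2 in the decrease of U calls for 4 C; the extra U
   keeps - e^2. *)
pose K := 4 * C + 1.
pose dV t := - (2 / eps) * dotv (X t) (X t)
  - 2 * 'D_1 (r i) t * dotv (X t) (P i *m b1).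
pose W := V + K \*: U.
pose dW t := dV t + K * dU t.
have dWE (t : R) : 0 < t -> (t%:E < T)%E -> is_derive t (1 : R) W (dW t).
  move=> t0 tT; have [dx dth [dr _]] := ode i t t0 tT.
  have dr' : is_derive t (1 : R) (r i) ('D_1 (r i) t).
    by apply: derivableP; exact: ex_derive.
  have dVE := is_derive_agent_energy eps_gt0 (P_lyapunov i) dx dth dr'.
  exact: (is_deriveD dVE (is_deriveZ K (dUE t t0 tT))).
have dWle (t : R) : 0 < t -> (t%:E < T)%E ->
    dW t <= - eps^-1 * dotv (X t) (X t) - (r i t - ystar) ^+ 2.
  move=> t0 tT; have K0 : 0 <= K by rewrite /K; lra.
  have := agent_energy_decrease (P i) eps_gt0 (x i) (r i) t ('D_1 (r i) t).
  have := ler_wpM2l K0 (dUle t i t0 tT); rewrite -/(X t) -/b1 -/C /dW -/(dV t).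
  have := sqr_ge0 ('D_1 (r i) t); have := sqr_ge0 (r i t - ystar).
  have := mulr_ge0 C0 (sqr_ge0 (r i t - ystar)).
  rewrite /K; lra.
have cW : {within horizon T, continuous W}.
  apply: within_continuousD; first exact: within_continuous_agent_energy.
  by apply: within_continuousM => //; exact: within_continuous_cst.
have dW0 (t : R) : 0 < t -> (t%:E < T)%E -> dW t <= 0.
  move=> t0 tT; apply: le_trans (dWle t t0 tT) _.
  rewrite subr_le0 (le_trans _ (sqr_ge0 _)) // mulNr oppr_le0.
  by rewrite mulr_ge0 ?dotv_ge0 // invr_ge0 ltW.
have Wle (t : R) : 0 <= t -> (t%:E < T)%E -> W t <= W 0.
  by move=> t0 tT; exact: (nonincreasing_horizon cW dWE dW0 (lexx 0) t0 tT).
have U0 t : 0 <= U t by rewrite (le_trans _ (Ule t i)) // mulr_ge0 ?sqr_ge0.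
have Wparts t : W t = dotv (X t) (P i *m X t)
    + eps ^+ n i * dotv (Th t) (Th t) + K * U t by [].
have XPX0 t : 0 <= dotv (X t) (P i *m X t) by exact: posdef_form_ge0.
have epsn_gt0 j : 0 < eps ^+ j by rewrite exprn_gt0.
have Th0 t : 0 <= eps ^+ n i * dotv (Th t) (Th t).
  by rewrite mulr_ge0 ?dotv_ge0 // ltW.
have UKU t : U t <= K * U t.
  by have := mulr_ge0 C0 (U0 t); rewrite /K; lra.
have W0 t : 0 <= W t by rewrite Wparts !addr_ge0 // (le_trans (U0 t)).
have [D XD] := posdef_coord_bound Ppd.
(* From e^2 <= 2 U <= 2 W 0 and |e| <= 1 + e^2. *)
pose Br := 1 + 2 * W 0 + `|ystar|.
have rB (t : R) : 0 <= t -> (t%:E < T)%E -> `|r i t| <= Br.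
  move=> t0 tT; rewrite -(subrK ystar (r i t)) (le_trans (ler_normD _ _)) //.
  rewrite lerD2r; have := Wle t t0 tT; have := Ule t i; have := UKU t.
  have := Th0 t; have := XPX0 t; rewrite Wparts.
  have := sqr_ge0 (r i t - ystar - 1); have := sqr_ge0 (r i t - ystar + 1).
  by move=> *; rewrite ler_norml; apply/andP; split; lra.
have XB (t : R) j : 0 <= t -> (t%:E < T)%E -> `|X t j 0| <= D + W 0.
  move=> t0 tT; apply: le_trans (XD _ _) _; rewrite lerD2l.
  apply: le_trans (Wle t t0 tT); rewrite Wparts.
  by have := UKU t; have := U0 t; have := Th0 t; lra.
pose Bx := \sum_(j < (n i).+1) (eps ^+ j)^-1 * (D + W 0 + Br).
have xB (t : R) j : 0 <= t -> (t%:E < T)%E -> `|x i t j 0| <= Bx.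
  move=> t0 tT; have Xj := XB t j t0 tT; have rt := rB t t0 tT.
  have S0 : 0 <= D + W 0 + Br.
    by rewrite addr_ge0 // ?(le_trans _ Xj) ?(le_trans _ rt).
  have -> : x i t j 0 = (eps ^+ j)^-1 * (X t j 0 + r i t * (j == ord0)%:R).
    by rewrite scaled_errorE subrK mulKf // gt_eqF.
  apply: le_trans (_ : (eps ^+ j)^-1 * (D + W 0 + Br) <= _); last first.
    rewrite /Bx (bigD1 j) //= lerDl sumr_ge0 // => l _.
    by rewrite mulr_ge0 // invr_ge0 ltW.
  have ej : 0 <= (eps ^+ j)^-1 by rewrite invr_ge0 ltW.
  rewrite normrM ger0_norm // ler_wpM2l // (le_trans (ler_normD _ _)) //.
  rewrite lerD // normrM; case: eqP => _; first by rewrite normr1 mulr1.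
  by rewrite normr0 mulr0 (le_trans _ rt).
split.
  exists (Num.sqrt (\sum_(j < (n i).+1) Bx ^+ 2)) => t t0 tT.
  rewrite /enorm ler_wsqrtr // dotvE ler_sum // => j _.
  have xj := xB t j t0 tT.
  rewrite -expr2 -real_normK ?num_real // lerXn2r ?nnegrE //.
  exact: le_trans xj.
move=> Too; have fin (t : R) : (t%:E < T)%E by rewrite Too ltry.
pose BT := Bx + Br + W 0 / eps ^+ n i.
have Bx0 : 0 <= Bx by apply: le_trans (xB 0 ord0 (lexx 0) (fin 0)).
have Br0 : 0 <= Br by apply: le_trans (rB 0 (lexx 0) (fin 0)).
have We0 : 0 <= W 0 / eps ^+ n i by rewrite divr_ge0 // ltW.
have [||||dy [M dyM]] := output_derivative_bounded (rho_smooth i) (p_bound i)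
    (theta := theta i) (k := k i) (eps := eps) (x := x i) (th := th i) (r := r i)
    (B := BT).
- by move=> t t0; have [] := ode i t t0 (fin t).
- by move=> t j t0; rewrite (le_trans (xB t j (ltW t0) (fin t))) // /BT; lra.
- by move=> t t0; rewrite (le_trans (rB t (ltW t0) (fin t))) // /BT; lra.
- move=> t t0; rewrite (@le_trans _ _ (W 0 / eps ^+ n i)) //; last by rewrite /BT; lra.
  rewrite ler_pdivlMr // mulrC; apply: le_trans (Wle t (ltW t0) (fin t)).
  by rewrite Wparts; have := UKU t; have := U0 t; have := XPX0 t; lra.
(* This c satisfies 2 c <= eps^-1 and 2 c <= 1, so that c (X_1 + e)^2 is below
   eps^-1 X_1^2 + e^2. *)
pose c := (2 * (eps + 1))^-1.
have eps1 : 0 < eps + 1 by exact: addr_gt0.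
have c2 : c * 2 = (eps + 1)^-1 by rewrite /c; field; rewrite gt_eqF.
apply: (@barbalat R W dW (fun t => x i t ord0 0 - ystar) dy c M).
- by rewrite invr_gt0 mulr_gt0.
- by move=> t _; exact: W0.
- by move=> t t0; exact: dWE.
- move=> t t0; apply: le_trans (dWle t t0 (fin t)) _.
  have X0 : X t ord0 0 = x i t ord0 0 - r i t by rewrite mxE eqxx.
  have XX := sqr_coord_le_dotv (X t) ord0; rewrite X0 in XX.
  have ceps : c * 2 <= eps^-1 by rewrite c2 lef_pV2 ?posrE // lerDl.
  have c1 : c * 2 <= 1 by rewrite c2 invf_le1 // lerDr ltW.
  have := ler_wpM2r (sqr_ge0 (r i t - ystar)) c1.
  have := ler_wpM2r (sqr_ge0 (x i t ord0 0 - r i t)) ceps.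
  have einv0 : 0 <= eps^-1 by rewrite invr_ge0 ltW.
  have := ler_wpM2l einv0 XX.
  have c0 : 0 <= c by rewrite invr_ge0 mulr_ge0 // ltW.
  have := mulr_ge0 c0 (sqr_ge0 (x i t ord0 0 - r i t - (r i t - ystar))).
  lra.
- move=> t t0; have [dyE _] := dyM t t0.
  rewrite (_ : (fun s => _) = (fun s => x i s ord0 0) - cst ystar) //.
  by apply: (is_derive_eq (is_deriveB dyE _)); rewrite subr0.
- by move=> t t0; have [] := dyM t t0.
Qed.
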